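(* Let $p$ be an odd prime and $a,b\in\mathbb Z_p$ with $ab(a^2-b^2)\not\equiv0\pmod p$. Then $$\sum_{k=0}^{[p/4]}\binom{4k}{2k}\Big(\frac{a^2-b^2}{16a^2}\Big)^k\equiv\frac1{2b}\Big(\frac{2a}p\Big)\Big\{(a+b)\Big(\frac{a+b}p\Big)-(a-b)\Big(\frac{a-b}p\Big)\Big\}\pmod p$$ and $$\sum_{k=0}^{[p/4]}\binom{4k}{2k}\Big(\frac{a^2}{16(a^2-b^2)}\Big)^k\equiv\begin{cases}\frac1{2b}\big\{(a+b)\big(\frac{a-b}p\big)-(a-b)\big(\frac{a+b}p\big)\big\}(b^2-a^2)^{\frac{p-1}4}\pmod p&\text{if }4\mid p-1,\\ \frac1{2b}\big\{\big(\frac{a+b}p\big)-\big(\frac{a-b}p\big)\big\}(b^2-a^2)^{\frac{p+1}4}\pmod p&\text{if }4\mid p-3.\end{cases}$$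
   Context: $[x]$ is the greatest integer $\le x$; $\mathbb Z_p$ is the set of rational numbers whose denominator is not divisible by $p$; $(\frac{\cdot}{p})$ is the Legendre symbol (extended to $\mathbb Z_p$ via residues). *)

(* Defs.v *)
From HB Require Import structures.
From mathcomp Require Import all_boot all_order all_algebra.
Set Implicit Arguments. Unset Strict Implicit. Unset Printing Implicit Defensive.
Import Order.TTheory GRing.Theory Num.Theory.
Local Open Scope ring_scope.

Definition in_Zp (p : nat) (x : rat) : bool := ~~ (p %| denq x)%Z.

(* congruence modulo p of rationals (in Z_p): p divides the numerator of x - y,
   i.e. (x - y)/p lies in Z_p *)
Definition cong_rat (p : nat) (x y : rat) : Prop := (p%:Z %| numq (x - y))%Z.

Definition legendreF (p : nat) (r : 'F_p) : int :=
  if r == 0 then 0 else if [exists y : 'F_p, y ^+ 2 == r] then 1 else -1.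

(* Legendre symbol extended to Z_p via residues: the residue of x = m/n
   (p not dividing n) in 'F_p is ratr x = m * n^-1. *)
Definition legendre_rat (p : nat) (x : rat) : int := legendreF (ratr x : 'F_p).

(* Main.v *)
(** Write [n = (p - 1) / 2]. Modulo [p], ['C(4k, 2k) / 16^k = C(-1/2, 2k)] is
    ['C(n, 2k)], so both sums are even parts [((1 + t)^n + (1 - t)^n) / 2].
    In an algebraic closure of ['F_p] choose [u^2 = a + b] and [v^2 = a - b];
    then [2 (a +- uv) = (u +- v)^2], so [(1 +- t)^n] is [(u +- v)^(p - 1)] up to
    a factor, which the Frobenius map evaluates after multiplication by
    [u^2 - v^2 = 2b]. Euler's criterion turns [(a +- b)^n] into Legendre
    symbols. The second sum also involves [2^n], which is computed from
    [(1 + i)^p] with [i^2 = -1]. *)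
Require Import Defs.
From HB Require Import structures.
From mathcomp Require Import all_boot all_order all_algebra.
From mathcomp Require Import all_field ring zify.
Import Order.TTheory GRing.Theory Num.Theory.
Local Open Scope ring_scope.

(** * Square roots, Frobenius and even parts of binomial expansions *)

Lemma closed_field_sqrt (K : closedFieldType) (x : K) : exists u, u ^+ 2 = x.
Proof.
have [//|u uE] := @solve_monicpoly K 2%N (fun i => if i == 0%N then x else 0).
by exists u; rewrite [LHS]uE !big_ord_recl big_ord0 /= expr0 mulr1 mul0r !addr0.
Qed.

Lemma pchar_exprDB (R : comNzRingType) (p : nat) (x y : R) :
  p \in [pchar R] ->
  (x + y) ^+ p = x ^+ p + y ^+ p /\ (x - y) ^+ p = x ^+ p - y ^+ p.
Proof.
move=> pR; rewrite -!(pFrobenius_autE pR).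
by rewrite pFrobenius_autD_comm ?pFrobenius_autB_comm //; apply: mulrC.
Qed.

Lemma sum_even_ord (R : nmodType) (n : nat) (F : nat -> R) :
  \sum_(i < n.+1 | ~~ odd i) F i = \sum_(k < n./2.+1) F (2 * k)%N.
Proof.
rewrite -(big_mkord (fun i => ~~ odd i)) -(big_mkord xpredT (fun k => F (2 * k)%N)).
elim: n => [|n IHn]; first by rewrite big_mkcond !big_nat1.
rewrite big_mkcond big_nat_recr // -big_mkcond /= {}IHn uphalf_half.
case: (boolP (odd n)) => on /=; last by rewrite addr0.
rewrite [RHS]big_nat_recr //=; congr (_ + F _); lia.
Qed.

(** The odd powers of [t] cancel. Only [t ^+ 2] enters the sum, so [t] may be taken as a square root
    in an extension field. *)
Lemma sum_even_bin (R : comPzRingType) (n : nat) (t : R) :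
  2 * \sum_(k < n./2.+1) 'C(n, 2 * k)%:R * (t ^+ 2) ^+ k =
  (1 + t) ^+ n + (1 - t) ^+ n.
Proof.
under eq_bigr do rewrite -exprM.
rewrite -(@sum_even_ord _ n (fun i => 'C(n, i)%:R * t ^+ i)).
rewrite !exprDn -big_split /= mulr_sumr big_mkcond; apply: eq_bigr => i _.
rewrite !expr1n !mul1r exprNn -signr_odd -[t ^+ i *+ _]mulr_natl -[_ * t ^+ i *+ _]mulr_natl.
by case: (odd i) => /=; rewrite ?expr0 ?expr1; ring.
Qed.

(** * Central binomial coefficients modulo an odd prime *)

Lemma mul_bin_centralS (k : nat) :
  (k.+1 * 'C(2 * k.+1, k.+1) = 2 * (2 * k).+1 * 'C(2 * k, k))%N.
Proof.
have kS : ((2 * k).+1 - k = k.+1)%N by lia.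
have -> : (2 * k.+1 = (2 * k).+2)%N by lia.
rewrite -mul_bin_diag /= -mulnA [((2 * k).+1 * _)%N]mul_bin_down kS.
by rewrite mulnA; congr (_ * _)%N; lia.
Qed.

(** Since [n] is [-1/2] in [F], both sides obey the same first-order recurrence in [k]. The bound
    [k <= n] keeps every factor [k.+1] below the characteristic, hence cancellable. *)
Lemma bin_central_pchar (F : fieldType) (n k : nat) :
  n.*2.+1 \in [pchar F] -> (k <= n)%N ->
  'C(2 * k, k)%:R = (- 4) ^+ k * 'C(n, k)%:R :> F.
Proof.
move=> pF; elim: k => [|k IHk] lekn; first by rewrite !bin0 expr0 mulr1.
have n2 : n%:R * 2 + 1 = 0 :> F.
  by rewrite -natrM natr1 muln2 (pcharf0 pF).
have k0 : k.+1%:R != 0 :> F.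
  by rewrite -(dvdn_pcharf pF); apply/negP => /dvdn_leq; lia.
apply: (mulfI k0).
have -> : k.+1%:R * 'C(2 * k.+1, k.+1)%:R =
          2 * (2 * k%:R + 1) * 'C(2 * k, k)%:R :> F.
  by rewrite -[LHS]natrM mul_bin_centralS !natrM -[(2 * k).+1%:R]natr1 natrM.
have e : k.+1%:R * 'C(n, k.+1)%:R = (n%:R - k%:R) * 'C(n, k)%:R :> F.
  by rewrite -[LHS]natrM mul_bin_left natrM natrB ?(ltnW lekn).
rewrite (IHk (ltnW lekn)) exprS [RHS]mulrCA {}e.
move: n2; move: (n%:R) => x n2.
(* The coefficients of the two recurrences differ by a multiple of [2n + 1], which is zero. *)
have -> : 2 * (2 * k%:R + 1) = -4 * (x - k%:R) + 2 * (x * 2 + 1) :> F by ring.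
rewrite n2; ring.
Qed.

(** * The even sums over an algebraically closed field *)

(** The characteristic is [p.+1]. The factor [u ^+ 2 - v ^+ 2 = (u - v) * (u + v)] gives each power
    the one factor it lacks for Frobenius, so nothing is divided by [u + v] or [u - v]. *)
Lemma pchar_pow_pred_DB (F : fieldType) (p : nat) (u v : F) :
  p.+1 \in [pchar F] -> 
  ((u + v) ^+ p + (u - v) ^+ p) * (u ^+ 2 - v ^+ 2) =
     2 * (u ^+ 2 * u ^+ p - v ^+ 2 * v ^+ p) /\
  ((u + v) ^+ p - (u - v) ^+ p) * (u ^+ 2 - v ^+ 2) =
     2 * (u * v) * (v ^+ p - u ^+ p).
Proof.
move=> pF; have [eD eB] := pchar_exprDB _ _ u v pF.
rewrite !exprS in eD eB; move: eD eB; move: (u ^+ p) (v ^+ p) ((u + v) ^+ p) ((u - v) ^+ p).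
move=> up vp dp bp eD eB; split.
  transitivity ((u - v) * ((u + v) * dp) + (u + v) * ((u - v) * bp)); first by ring.
  rewrite [_ * dp]eD [_ * bp]eB; ring.
transitivity ((u - v) * ((u + v) * dp) - (u + v) * ((u - v) * bp)); first by ring.
rewrite [_ * dp]eD [_ * bp]eB; ring.
Qed.

Lemma two_neq0_pchar (F : fieldType) (n : nat) :
  n.*2.+1 \in [pchar F] -> 2 != 0 :> F.
Proof.
move=> pF; rewrite -(dvdn_pcharf pF); apply/negP => /dvdn_leq n1.
have n0 : n = 0%N by lia.
by have := pcharf_prime pF; rewrite n0.
Qed.

Section Closed.
Variables (K : closedFieldType) (n : nat).
Hypothesis pK : n.*2.+1 \in [pchar K].

(** The supplementary law for 2: compare [(1 + i) * (2 * i) ^+ n], which is the power of [1 + i] to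
    the characteristic, with its Frobenius value [1 + i * (-1) ^+ n]. *)
Lemma pow2_half_pchar : (2 : K) ^+ n = (- 1) ^+ (uphalf n).
Proof.
have [i iE] := closed_field_sqrt _ (- 1 : K).
have [e _] := pchar_exprDB _ _ 1 i pK.
have e2 : (1 + i) ^+ 2 = 2 * i by rewrite -[1 + i]addrC sqrrD1 iE; ring.
have i0 : (1 + i) * (1 - i) = 2 by rewrite mulrC -subr_sqr expr1n iE; ring.
have : (1 + i) * (1 - i) != 0 by rewrite i0 (two_neq0_pchar _ _ pK).
rewrite mulf_eq0 negb_or => /andP[ip0 im0].
move: e; rewrite !exprS expr1n mulr1 -mul2n !exprM e2 exprMn iE uphalf_half.
rewrite -[in i ^+ n](odd_double_half n) -[in (-1) ^+ n]signr_odd.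
rewrite -[_./2.*2]mul2n exprD exprM iE.
have s2 : (-1) ^+ n./2 * (-1) ^+ n./2 = 1 :> K by rewrite -expr2 sqrr_sign.
rewrite exprD; move: s2; move: ((-1) ^+ n./2) => s s2.
case: (odd n); rewrite ?(expr0, expr1, mul1r) => e.
  (* For odd [n] the Frobenius value is [1 - i], and [1 - i = - (1 + i) * i], so [1 - i] is
     cancelled here; the extra terms below vanish by [i ^+ 2 = -1] and [s * s = 1]. *)
  apply: (mulfI im0); move: (2 ^+ n) e => t e.
  have -> : (1 - i) * t = - ((1 + i) * (t * (i * s))) * s
      + (i ^+ 2 + 1) * t * (s * s) + (1 - i) * t * (1 - s * s) by ring.
  by rewrite e iE s2; ring.
apply: (mulfI ip0); move: (2 ^+ n) e => t e.
have -> : (1 + i) * t = ((1 + i) * (t * s)) * s + (1 + i) * t * (1 - s * s).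
  by ring.
by rewrite e s2; ring.
Qed.

Variables (a b : K).
Hypotheses (a0 : a != 0) (b0 : b != 0) (ab0 : a ^+ 2 - b ^+ 2 != 0).
Let n2 := (two_neq0_pchar _ _ pK).

Lemma sum_even_bin_closed :
  \sum_(k < n./2.+1) 'C(n, 2 * k)%:R * ((a ^+ 2 - b ^+ 2) / a ^+ 2) ^+ k =
  (2 * b)^-1 * (2 * a) ^- n * ((a + b) * (a + b) ^+ n - (a - b) * (a - b) ^+ n).
Proof.
have [u uE] := closed_field_sqrt _ (a + b).
have [v vE] := closed_field_sqrt _ (a - b).
have aE : 2 * a = u ^+ 2 + v ^+ 2 by rewrite uE vE; ring.
have bE : 2 * b = u ^+ 2 - v ^+ 2 by rewrite uE vE; ring.
(* This is the choice [t = u * v / a], which makes [1 + t] and [1 - t] squares up to [2 * a]. *)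
have -> : (a ^+ 2 - b ^+ 2) / a ^+ 2 = (u * v / a) ^+ 2.
  by rewrite expr_div_n exprMn uE vE; congr (_ / _); ring.
apply: (mulfI n2); rewrite sum_even_bin.
have -> : 1 + u * v / a = (u + v) ^+ 2 / (2 * a).
  rewrite (_ : (u + v) ^+ 2 = 2 * a + 2 * (u * v)); last by rewrite aE; ring.
  by field; rewrite a0 n2.
have -> : 1 - u * v / a = (u - v) ^+ 2 / (2 * a).
  rewrite (_ : (u - v) ^+ 2 = 2 * a - 2 * (u * v)); last by rewrite aE; ring.
  by field; rewrite a0 n2.
rewrite -uE -vE !expr_div_n -!exprM !mul2n.
have [e _] := pchar_pow_pred_DB _ _ u v pK.
have b20 : 2 * b != 0 by rewrite mulf_neq0.
apply: (mulIf b20); rewrite -mulrDl mulrAC {1}bE e.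
rewrite -mul2n !exprM; field.
by rewrite expf_neq0 ?mulf_neq0 ?b0 ?n2.
Qed.

(** Now [t = a / (u * v)], and [1 - t] acquires a minus sign. Hence [(-1) ^+ n] decides whether the
    sum or the difference of the powers of [u + v] and [u - v] appears, which produces the split on
    [odd n]. *)
Lemma sum_even_bin_closed_inv :
  \sum_(k < n./2.+1) 'C(n, 2 * k)%:R * (a ^+ 2 / (a ^+ 2 - b ^+ 2)) ^+ k =
  (2 * b)^-1 * (b ^+ 2 - a ^+ 2) ^- (n./2) *
  (if odd n then (a + b) ^+ n - (a - b) ^+ n
   else (a + b) * (a + b) ^+ n - (a - b) * (a - b) ^+ n).
Proof.
have [u uE] := closed_field_sqrt _ (a + b).
have [v vE] := closed_field_sqrt _ (a - b).
have aE : 2 * a = u ^+ 2 + v ^+ 2 by rewrite uE vE; ring.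
have bE : 2 * b = u ^+ 2 - v ^+ 2 by rewrite uE vE; ring.
have sE : a ^+ 2 - b ^+ 2 = (u * v) ^+ 2 by rewrite exprMn uE vE; ring.
have s0 : u * v != 0 by move: ab0; rewrite sE expf_eq0.
have [u0 v0] : u != 0 /\ v != 0 by move: s0; rewrite mulf_eq0 negb_or => /andP.
have b20 : 2 * b != 0 by rewrite mulf_neq0.
have -> : b ^+ 2 - a ^+ 2 = - (u * v) ^+ 2 by rewrite -sE; ring.
rewrite sE -expr_div_n; apply: (mulfI n2); rewrite sum_even_bin.
have -> : 1 + a / (u * v) = (u + v) ^+ 2 / (2 * (u * v)).
  rewrite (_ : (u + v) ^+ 2 = 2 * a + 2 * (u * v)); last by rewrite aE; ring.
  by field; rewrite u0 v0 n2.
have -> : 1 - a / (u * v) = - (u - v) ^+ 2 / (2 * (u * v)).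
  rewrite (_ : (u - v) ^+ 2 = 2 * a - 2 * (u * v)); last by rewrite aE; ring.
  by field; rewrite u0 v0 n2.
rewrite -uE -vE !expr_div_n exprNn -!exprM !mul2n.
have [eD eB] := pchar_pow_pred_DB _ _ u v pK.
(* The value of [2 ^+ n] turns the denominator into a power of [- (u * v) ^+ 2 = b ^+ 2 - a ^+ 2];
   for odd [n] the leftover [- (u * v)] cancels the factor [u * v] in [eB]. *)
have dE : (2 * (u * v)) ^+ n =
    (if odd n then - (u * v) else 1) * (- (u * v) ^+ 2) ^+ n./2.
  rewrite exprMn pow2_half_pchar uphalf_half [(- _) ^+ n./2]exprNn.
  rewrite -[in (u * v) ^+ n](odd_double_half n) -addnn !exprD.
  by rewrite [_ ^+ 2 ^+ _]exprAC; case: (odd n); rewrite ?(expr0, expr1); ring.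
have w0 : (- (u * v) ^+ 2) ^+ n./2 != 0 by rewrite expf_neq0 ?oppr_eq0 ?expf_neq0.
rewrite -[(-1) ^+ n]signr_odd; move: dE w0.
move: ((2 * _) ^+ n) (_ ^+ n./2) => d w -> w0.
apply: (mulIf b20).
case: (odd n); rewrite /= ?(expr0, expr1, mulN1r, mul1r) -mulrDl mulrAC {1}bE.
  by rewrite eB; field; rewrite w0 b0 n2 oppr_eq0 mulf_neq0.
by rewrite eD; field; rewrite ?w0 ?b0.
Qed.
End Closed.

(** At index [2 * k] the factor [(- 4) ^+ (2 * k)] is [16 ^+ k] and cancels the 16. The range is
    right because the characteristic divided by 4 is [n./2], so [2 * k <= n]. *)
Lemma sum_bin_central_pchar (F : fieldType) (n : nat) (x y : F) :
  n.*2.+1 \in [pchar F] ->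
  \sum_(k < (n.*2.+1 %/ 4).+1) 'C(4 * k, 2 * k)%:R * (x / (16 * y)) ^+ k =
  \sum_(k < n./2.+1) 'C(n, 2 * k)%:R * (x / y) ^+ k.
Proof.
move=> pF; have -> : (n.*2.+1 %/ 4 = n./2)%N by lia.
have n2 := two_neq0_pchar _ _ pF.
have n16 : 16 != 0 :> F.
  by rewrite (_ : 16 = 2 ^+ 4) ?expf_neq0 //; ring.
apply: eq_bigr => k _; rewrite -[4%N]/(2 * 2)%N -mulnA (bin_central_pchar _ n) //; last first.
  by have := ltn_ord k; lia.
rewrite exprM (_ : (- 4) ^+ 2 = 16 :> F); last by ring.
have -> : (x / (16 * y)) ^+ k = (x / y) ^+ k / 16 ^+ k.
  by rewrite invfM mulrCA exprMn exprVn mulrC.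
by rewrite [16 ^+ k * _]mulrC -mulrA [16 ^+ k * _]mulrCA mulfV ?mulr1 ?expf_neq0.
Qed.

(** * Euler's criterion and the identities in the prime field *)

Section PrimeField.
Variable p : nat.
Hypotheses (p_pr : prime p) (p_odd : odd p).

Let pE : p = p./2.*2.+1.
Proof. by rewrite -[LHS]odd_double_half p_odd. Qed.

Lemma half_pchar_Fp : p./2.*2.+1 \in [pchar 'F_p].
Proof. by rewrite -pE pchar_Fp. Qed.

Lemma Fp_closure : exists (K : closedFieldType), inhabited {rmorphism 'F_p -> K}.
Proof. by have [K [f _]] := countable_algebraic_closure 'F_p; exists K. Qed.

Lemma Fp_pow_half_sqr (x : 'F_p) : x != 0 -> x ^+ p./2 * x ^+ p./2 = 1.
Proof.
move=> x0; apply: (mulfI x0); rewrite -exprD addnn -exprS -pE mulr1.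
by rewrite -[RHS]expf_card card_Fp.
Qed.

(** Euler's criterion. For [x != 0] the power is 1 or -1 by Fermat, and the real content is that the
    value 1 forces [x] to be a square. *)
Lemma legendreF_pow (x : 'F_p) : (legendreF x)%:~R = x ^+ p./2 :> 'F_p.
Proof.
rewrite /legendreF; case: eqVneq => [->|x0].
  by rewrite expr0n; case: (p./2) pE (p_pr) => // ->.
case: existsP => [[y /eqP yE]|nsq].
  have y0 : y != 0 by move: x0; rewrite -yE expf_eq0.
  by rewrite -yE -exprM mulnC exprM expr2 Fp_pow_half_sqr.
have := Fp_pow_half_sqr _ x0; rewrite -expr2 => /eqP.
rewrite sqrf_eq1 => /orP[/eqP x1|/eqP-> //].
(* A square root [u] of [x] in the closure satisfies [u ^+ p = u * x ^+ p./2 = u]. As ['X^p - 'X]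
   splits over ['F_p], its root [u] comes from ['F_p]. *)
case: nsq; have [K [f]] := Fp_closure.
have [u uE] := closed_field_sqrt _ (f x).
have up : u ^+ #|'F_p| - u = 0.
  rewrite card_Fp // pE exprS -mul2n exprM uE -rmorphXn /= x1 rmorph1.
  by rewrite mulr1 subrr.
have : root (map_poly f ('X^#|'F_p| - 'X)) u.
  by rewrite rmorphB /= map_polyXn map_polyX rootE !hornerE up.
rewrite finField_genPoly rmorph_prod rootE horner_prod /=.
rewrite prodf_seq_eq0 => /hasP[y _]; rewrite rmorphB /= map_polyX map_polyC /=.
rewrite !hornerE subr_eq0 => /eqP uy.
by exists y; rewrite -(inj_eq (fmorph_inj f)) rmorphXn /= -uy uE.
Qed.

Variables (a b : 'F_p).
Hypotheses (a0 : a != 0) (b0 : b != 0) (ab0 : a ^+ 2 - b ^+ 2 != 0).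

Let n2 : 2 != 0 :> 'F_p := two_neq0_pchar _ _ half_pchar_Fp.

(** The auxiliary roots no longer occur in the closed-field identity, so it pulls back along the
    injective [f]. *)
Lemma sum_even_bin_Fp :
  \sum_(k < p./2./2.+1) 'C(p./2, 2 * k)%:R * ((a ^+ 2 - b ^+ 2) / a ^+ 2) ^+ k =
  (2 * b)^-1 * (2 * a) ^- p./2 *
    ((a + b) * (a + b) ^+ p./2 - (a - b) * (a - b) ^+ p./2).
Proof.
have [K [f]] := Fp_closure; apply: (fmorph_inj f).
have f2 : f 2 = 2 := rmorph_nat f 2.
have pK : p./2.*2.+1 \in [pchar K] by rewrite (fmorph_pchar f) half_pchar_Fp.
have := sum_even_bin_closed K _ pK (f a) (f b).
rewrite !fmorph_eq0 => /(_ a0 b0).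
rewrite rmorph_sum !(f2, rmorphM, rmorphB, rmorphD, rmorphXn, fmorphV, rmorph_nat) /= => <-.
apply: eq_bigr => k _.
by rewrite !(f2, rmorphM, rmorphB, rmorphD, rmorphXn, fmorphV, rmorph_nat).
Qed.

Lemma sum_even_bin_Fp_inv :
  \sum_(k < p./2./2.+1) 'C(p./2, 2 * k)%:R * (a ^+ 2 / (a ^+ 2 - b ^+ 2)) ^+ k =
  (2 * b)^-1 * (b ^+ 2 - a ^+ 2) ^- (p./2./2) *
  (if odd p./2 then (a + b) ^+ p./2 - (a - b) ^+ p./2
   else (a + b) * (a + b) ^+ p./2 - (a - b) * (a - b) ^+ p./2).
Proof.
have [K [f]] := Fp_closure; apply: (fmorph_inj f).
have f2 : f 2 = 2 := rmorph_nat f 2.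
have pK : p./2.*2.+1 \in [pchar K] by rewrite (fmorph_pchar f) half_pchar_Fp.
have := sum_even_bin_closed_inv K _ pK (f a) (f b).
have fab0 : f a ^+ 2 - f b ^+ 2 != 0 by rewrite -!rmorphXn -rmorphB fmorph_eq0.
rewrite !fmorph_eq0 => /(_ b0 fab0).
rewrite rmorph_sum [in X in _ -> X]rmorphM (fun_if f).
rewrite !(f2, rmorphM, rmorphB, rmorphD, rmorphXn, fmorphV, rmorph_nat) /= => <-.
apply: eq_bigr => k _.
by rewrite !(f2, rmorphM, rmorphB, rmorphD, rmorphXn, fmorphV, rmorph_nat).
Qed.

Let ab_neq0 : a + b != 0 /\ a - b != 0.
Proof. by move: ab0; rewrite subr_sqr mulf_eq0 negb_or => /andP[]. Qed.

Lemma sum_bin_Fp :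
  \sum_(k < (p %/ 4).+1)
     'C(4 * k, 2 * k)%:R * ((a ^+ 2 - b ^+ 2) / (16 * a ^+ 2)) ^+ k =
  (2 * b)^-1 * (legendreF (2 * a))%:~R *
    ((a + b) * (legendreF (a + b))%:~R - (a - b) * (legendreF (a - b))%:~R).
Proof.
rewrite [X in (X %/ 4)%N]pE (sum_bin_central_pchar _ _ _ _ half_pchar_Fp).
rewrite sum_even_bin_Fp !legendreF_pow; congr (_ * _ * _).
have a20 : 2 * a != 0 by rewrite mulf_neq0.
(* The power of [2 * a] is a sign, hence its own inverse. *)
apply: (mulfI (expf_neq0 p./2 a20)).
by rewrite Fp_pow_half_sqr // mulfV // expf_neq0.
Qed.

Lemma sum_bin_Fp_inv1 : (4 %| p - 1)%N ->
  \sum_(k < (p %/ 4).+1)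
     'C(4 * k, 2 * k)%:R * (a ^+ 2 / (16 * (a ^+ 2 - b ^+ 2))) ^+ k =
  (2 * b)^-1 *
    ((a + b) * (legendreF (a - b))%:~R - (a - b) * (legendreF (a + b))%:~R)
  * (b ^+ 2 - a ^+ 2) ^+ ((p - 1) %/ 4).
Proof.
move=> p1; have on : odd p./2 = false by lia.
have mE : ((p - 1) %/ 4 = p./2./2)%N by lia.
have nE : (p./2 = p./2./2 * 2)%N by lia.
rewrite [X in (X %/ 4).+1]pE (sum_bin_central_pchar _ _ _ _ half_pchar_Fp).
rewrite sum_even_bin_Fp_inv on !legendreF_pow mE -!mulrA; congr (_ * _).
have [/Fp_pow_half_sqr A2 /Fp_pow_half_sqr B2] := ab_neq0.
have w2 : ((b ^+ 2 - a ^+ 2) ^+ p./2./2) ^+ 2 = (a + b) ^+ p./2 * (a - b) ^+ p./2.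
  rewrite -exprM -nE -exprMn mulrC -subr_sqr -[b ^+ 2 - _]opprB exprNn.
  by rewrite -signr_odd on mul1r.
have w0 : (b ^+ 2 - a ^+ 2) ^+ p./2./2 != 0 by rewrite expf_neq0 // -opprB oppr_eq0.
(* Inverting the power of [b ^+ 2 - a ^+ 2] costs a factor [A * B]; since [A] and [B] square to 1,
   this swaps the two Legendre symbols. *)
apply: (mulfI w0); rewrite mulVKf // [RHS]mulrCA -expr2 w2.
move: A2 B2; move: ((a + b) ^+ _) ((a - b) ^+ _) => A B A2 B2.
transitivity ((a + b) * A * (B * B) - (a - b) * B * (A * A)); last by ring.
by rewrite A2 B2 !mulr1.
Qed.

Lemma sum_bin_Fp_inv3 : (4 %| p - 3)%N ->
  \sum_(k < (p %/ 4).+1)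
     'C(4 * k, 2 * k)%:R * (a ^+ 2 / (16 * (a ^+ 2 - b ^+ 2))) ^+ k =
  (2 * b)^-1 * ((legendreF (a + b))%:~R - (legendreF (a - b))%:~R)
  * (b ^+ 2 - a ^+ 2) ^+ ((p + 1) %/ 4).
Proof.
move=> p3; have p2 : (1 < p)%N by apply: prime_gt1.
have on : odd p./2 = true by lia.
have mE : ((p + 1) %/ 4 = (p./2./2).+1)%N by lia.
have nE : (p./2 = (p./2./2 * 2).+1)%N by lia.
rewrite [X in (X %/ 4).+1]pE (sum_bin_central_pchar _ _ _ _ half_pchar_Fp).
rewrite sum_even_bin_Fp_inv on !legendreF_pow mE -!mulrA; congr (_ * _).
have [/Fp_pow_half_sqr A2 /Fp_pow_half_sqr B2] := ab_neq0.
(* The two exponents add up to the odd number [p./2], whence the minus sign. *)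
have w2 : (b ^+ 2 - a ^+ 2) ^+ (p./2./2).+1 * (b ^+ 2 - a ^+ 2) ^+ p./2./2 =
    - ((a + b) ^+ p./2 * (a - b) ^+ p./2).
  rewrite exprS -mulrA -expr2 -exprM -exprS -nE -exprMn mulrC.
  by rewrite -mulrC [(a + b) * _]mulrC -subr_sqr -[b ^+ 2 - _]opprB exprNn
    -signr_odd on mulN1r.
have w0 : (b ^+ 2 - a ^+ 2) ^+ p./2./2 != 0 by rewrite expf_neq0 // -opprB oppr_eq0.
apply: (mulfI w0); rewrite mulVKf // [RHS]mulrC -mulrA w2.
move: A2 B2; move: ((a + b) ^+ _) ((a - b) ^+ _) => A B A2 B2.
transitivity (A * (B * B) - B * (A * A)); last by ring.
by rewrite A2 B2 !mulr1.
Qed.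
End PrimeField.

(** * Residues of rationals integral at [p] *)

(** [ratr] into ['F_p] respects sums and products only for denominators prime to [p], so integrality
    is carried along with the residue. *)
Definition residue_at (p : nat) (x : rat) (r : 'F_p) : Prop :=
  in_Zp p x /\ ratr x = r.

Section Residue.
Variable p : nat.
Hypothesis p_pr : prime p.
Notation res := (residue_at p).

Let pF := pchar_Fp p_pr.

(** An unreduced fraction also computes the residue: [denq x] divides [d] by coprimality with
    [numq x], so it stays prime to [p]. Closure under field operations thus becomes fraction
    arithmetic. *)
Lemma residue_frac (x : rat) (m d : int) :
  d%:~R != 0 :> 'F_p -> x * d%:~R = m%:~R -> res x (m%:~R / d%:~R).
Proof.
move=> d0 xE.
have nd : numq x * d = m * denq x.
  by apply: (@intr_inj rat); rewrite !intrM -xE numqE mulrAC.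
have x0 : (denq x)%:~R != 0 :> 'F_p.
  apply: contraNneq d0 => /eqP.
  rewrite -!(dvdz_pcharf pF) => pd; apply: dvdz_trans pd _.
  by rewrite -(@Gauss_dvdzr _ (numq x)) ?nd ?dvdz_mull // coprimez_sym coprimezE coprime_num_den.
split; first by rewrite /in_Zp (dvdz_pcharf pF).
by apply/eqP; rewrite eqr_div // -!intrM nd.
Qed.

Lemma residueP (x : rat) (r : 'F_p) : res x r ->
  exists m d : int, [/\ d%:~R != 0 :> 'F_p, d%:~R != 0 :> rat,
    x * d%:~R = m%:~R & r = m%:~R / d%:~R].
Proof.
case=> xp <-; exists (numq x), (denq x); split=> //.
- by rewrite -(dvdz_pcharf pF).
- by rewrite intr_eq0 denq_neq0.
- by rewrite numqE.
Qed.

Lemma residueD x y r s : res x r -> res y s -> res (x + y) (r + s).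
Proof.
move=> /residueP[m [d [d0 _ xE ->]]] /residueP[m' [d' [d'0 _ yE ->]]].
rewrite addf_div // -!intrM -intrD; apply: residue_frac.
  by rewrite intrM mulf_neq0.
by rewrite intrD !intrM -xE -yE; ring.
Qed.

Lemma residueM x y r s : res x r -> res y s -> res (x * y) (r * s).
Proof.
move=> /residueP[m [d [d0 _ xE ->]]] /residueP[m' [d' [d'0 _ yE ->]]].
rewrite mulf_div -!intrM; apply: residue_frac.
  by rewrite intrM mulf_neq0.
by rewrite !intrM -xE -yE; ring.
Qed.

Lemma residueV x r : r != 0 -> res x r -> res x^-1 r^-1.
Proof.
move=> r0 /residueP[m [d [d0 dq xE rE]]].
have m0 : m%:~R != 0 :> 'F_p by apply: contraNneq r0 => m0; rewrite rE m0 mul0r.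
rewrite rE invf_div; apply: residue_frac => //.
have x0 : x != 0.
  apply: contraNneq m0 => x0; move: xE; rewrite x0 mul0r => /esym/eqP.
  by rewrite intr_eq0 => /eqP ->.
by rewrite -xE mulKf.
Qed.

Lemma residue_int (m : int) : res m%:~R m%:~R.
Proof.
by rewrite -[X in res _ X]divr1; apply: (residue_frac _ m 1); rewrite ?oner_neq0 // mulr1.
Qed.

Lemma residue_nat (m : nat) : res m%:R m%:R.
Proof. exact: (residue_int m). Qed.

Lemma residueN x r : res x r -> res (- x) (- r).
Proof.
by move=> xr; rewrite -mulN1r -[- r]mulN1r; apply: residueM (residue_int (-1)) xr.
Qed.

Lemma residueX x r k : res x r -> res (x ^+ k) (r ^+ k).
Proof.
move=> xr; elim: k => [|k IHk]; first exact: (residue_nat 1).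
by rewrite !exprS; apply: residueM.
Qed.

Lemma residue_sum (n : nat) (f : nat -> rat) (g : nat -> 'F_p) :
  (forall k, res (f k) (g k)) -> res (\sum_(k < n) f k) (\sum_(k < n) g k).
Proof.
move=> fg; elim: n => [|n IHn]; first by rewrite !big_ord0; apply: (residue_nat 0).
by rewrite !big_ord_recr /=; apply: residueD.
Qed.

Lemma residue_cong x y r : res x r -> res y r -> cong_rat p x y.
Proof.
move=> xr /residueN /(residueD _ _ _ _ xr)[]; rewrite subrr /cong_rat /in_Zp.
rewrite !(dvdz_pcharf pF) => d0 /eqP; rewrite mulf_eq0 invr_eq0.
by rewrite (negPf d0) orbF.
Qed.

Lemma residue_legendre x r : res x r -> legendre_rat p x = legendreF r.
Proof. by case=> _ <-. Qed.
End Residue.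

Theorem theorem2p4 (p : nat) (a b : rat) :
  prime p -> odd p -> in_Zp p a -> in_Zp p b ->
  ~ cong_rat p (a * b * (a ^+ 2 - b ^+ 2)) 0 ->
  cong_rat p
    (\sum_(k < (p %/ 4).+1)
        ('C(4 * k, 2 * k))%:R * ((a ^+ 2 - b ^+ 2) / (16 * a ^+ 2)) ^+ k)
    ((2 * b)^-1 * (legendre_rat p (2 * a))%:~R *
       ((a + b) * (legendre_rat p (a + b))%:~R
        - (a - b) * (legendre_rat p (a - b))%:~R))
  /\
  ((4 %| p - 1)%N ->
   cong_rat p
    (\sum_(k < (p %/ 4).+1)
        ('C(4 * k, 2 * k))%:R * (a ^+ 2 / (16 * (a ^+ 2 - b ^+ 2))) ^+ k)
    ((2 * b)^-1 *
       ((a + b) * (legendre_rat p (a - b))%:~R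
        - (a - b) * (legendre_rat p (a + b))%:~R)
     * (b ^+ 2 - a ^+ 2) ^+ ((p - 1) %/ 4)))
  /\
  ((4 %| p - 3)%N ->
   cong_rat p
    (\sum_(k < (p %/ 4).+1)
        ('C(4 * k, 2 * k))%:R * (a ^+ 2 / (16 * (a ^+ 2 - b ^+ 2))) ^+ k)
    ((2 * b)^-1 *
       ((legendre_rat p (a + b))%:~R - (legendre_rat p (a - b))%:~R)
     * (b ^+ 2 - a ^+ 2) ^+ ((p + 1) %/ 4))).

Proof.
move=> p_pr p_odd azp bzp nab.
have ra : residue_at p a (ratr a) by [].
have rb : residue_at p b (ratr b) by [].
move: (ratr a : 'F_p) (ratr b : 'F_p) ra rb => r s ra rb.
(* The closure rules let residues be built along the syntax of each side. *)
pose res := @residue_at p.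
have rD x y t u : res x t -> res y u -> res (x + y) (t + u) by apply: residueD.
have rB x y t u : res x t -> res y u -> res (x - y) (t - u).
  by move=> xt yu; apply rD => //; apply: residueN.
have rM x y t u : res x t -> res y u -> res (x * y) (t * u) by apply: residueM.
have rX x t k : res x t -> res (x ^+ k) (t ^+ k) by apply: residueX.
have rV x t : t != 0 -> res x t -> res x^-1 t^-1 by apply: residueV.
have rn m : res m%:R m%:R by apply: residue_nat.
have rL x t : res x t -> res (legendre_rat p x)%:~R (legendreF t)%:~R.
  by move=> /residue_legendre ->; apply: residue_int.
have rS x t : res x t ->
    res (\sum_(k < (p %/ 4).+1) 'C(4 * k, 2 * k)%:R * x ^+ k)
        (\sum_(k < (p %/ 4).+1) 'C(4 * k, 2 * k)%:R * t ^+ k).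
  move=> xt; apply: (residue_sum _ p_pr _
    (fun k => 'C(4 * k, 2 * k)%:R * x ^+ k)
    (fun k => 'C(4 * k, 2 * k)%:R * t ^+ k)) => k.
  by apply rM => //; apply rX.
(* A vanishing residue would give the excluded congruence with 0. *)
have : r * s * (r ^+ 2 - s ^+ 2) != 0.
  apply/eqP => rs0; apply: nab; apply: (residue_cong _ p_pr _ _ 0); last apply (rn 0%N).
  by rewrite -rs0; apply rM; [apply rM | apply rB; apply rX].
rewrite !mulf_eq0 !negb_or => /andP[/andP[r0 s0] rs0].
have n2 : 2 != 0 :> 'F_p := two_neq0_pchar _ _ (half_pchar_Fp _ p_pr p_odd).
have n16 : 16 != 0 :> 'F_p by rewrite (_ : 16 = 2 ^+ 4) ?expf_neq0 //; ring.
have r2b : res (2 * b)^-1 (2 * s)^-1.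
  by apply rV; [rewrite mulf_neq0|apply rM].
have rLD := rL _ _ (rD _ _ _ _ ra rb).
have rLB := rL _ _ (rB _ _ _ _ ra rb).
have rx : res ((a ^+ 2 - b ^+ 2) / (16 * a ^+ 2))
              ((r ^+ 2 - s ^+ 2) / (16 * r ^+ 2)).
  apply rM; first by apply rB; apply rX.
  apply rV; first by rewrite mulf_neq0 ?expf_neq0.
  by apply rM => //; apply rX.
have ry : res (a ^+ 2 / (16 * (a ^+ 2 - b ^+ 2)))
              (r ^+ 2 / (16 * (r ^+ 2 - s ^+ 2))).
  apply rM; first by apply rX.
  apply rV; first by rewrite mulf_neq0.
  by apply rM => //; apply rB; apply rX.
have rw k : res ((b ^+ 2 - a ^+ 2) ^+ k) ((s ^+ 2 - r ^+ 2) ^+ k).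
  by apply rX; apply rB; apply rX.
split; [|split=> [p1|p3]].
(* In each case the left side has the sum in ['F_p] as residue; the prime-field identity rewrites it
   into the residue of the right side. *)
- apply: (residue_cong _ p_pr _ _ _ (rS _ _ rx)); rewrite (sum_bin_Fp p p_pr p_odd) //.
  apply rM; first by apply rM => //; apply rL; apply rM.
  by apply rB; apply rM => //; [apply rD | apply rB].
- apply: (residue_cong _ p_pr _ _ _ (rS _ _ ry)); rewrite (sum_bin_Fp_inv1 p p_pr p_odd) //.
  apply rM => //; apply rM => //.
  by apply rB; apply rM => //; [apply rD | apply rB].
- apply: (residue_cong _ p_pr _ _ _ (rS _ _ ry)); rewrite (sum_bin_Fp_inv3 p p_pr p_odd) //.
  by apply rM => //; apply rM => //; apply rB.
Qed.
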